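(* Let $a \geq 2$ be an integer. Then for every positive integer $n$, the integer $G_{n,a}$ is a multiple of $\pi_a(n)$.
   Context: For an integer $a \geq 2$, the generalized Genocchi numbers $G_{n,a}$ ($n \geq 0$) are defined by the power series expansion $$\frac{a t}{e^{(a-1)t} + e^{(a-2)t} + \dots + e^t + 1} = \sum_{n=0}^{\infty} G_{n,a} \frac{t^n}{n!};$$ it is known that all $G_{n,a}$ are integers. For positive integers $a$ and $n$, $\pi_a(n)$ denotes the greatest positive divisor of $n$ that is coprime to $a$, i.e. $\pi_a(n) = \prod_{p \text{ prime},\, p \nmid a} p^{\vartheta_p(n)}$, where $\vartheta_p$ is the $p$-adic valuation. *)

(* Defs.v *)
From HB Require Import structures.
From mathcomp Require Import all_boot all_order all_algebra.
Set Implicit Arguments.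
Unset Strict Implicit.
Unset Printing Implicit Defensive.
Import Order.TTheory GRing.Theory Num.Theory.
Local Open Scope ring_scope.

(* Formal power series over F, given by their coefficient sequences. *)
Definition fps (F : fieldType) := nat -> F.

Definition fps_mul (F : fieldType) (s t : fps F) : fps F :=
  fun n => \sum_(i < n.+1) s i * t (n - i)%N.

(* [fps_inv_seq s n] lists the first n coefficients of 1/s, computed by the
   usual recursion v_0 = 1/s_0, v_m = - (1/s_0) sum_(i < m) v_i s_(m-i). *)
Fixpoint fps_inv_seq (F : fieldType) (s : fps F) (n : nat) : seq F :=
  if n is m.+1 then
    let v := fps_inv_seq s m in
    rcons v ((s 0%N)^-1 * ((m == 0%N)%:R - \sum_(i < m) v`_i * s (m - i)%N))
  else [::].

(* Meaningful only when s has a nonzero constant coefficient. *)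
Definition fps_inv (F : fieldType) (s : fps F) : fps F :=
  fun n => (fps_inv_seq s n.+1)`_n.

Definition fps_div (F : fieldType) (s t : fps F) : fps F :=
  fps_mul s (fps_inv t).

Lemma size_fps_inv_seq (F : fieldType) (s : fps F) n :
  size (fps_inv_seq s n) = n.
Proof. by elim: n => //= n IHn; rewrite size_rcons IHn. Qed.

Lemma nth_fps_inv_seq (F : fieldType) (s : fps F) n i :
  (i < n)%N -> (fps_inv_seq s n)`_i = fps_inv s i.
Proof.
elim: n => // n IHn; rewrite ltnS leq_eqVlt => /predU1P[-> //|lt_in].
by rewrite /= nth_rcons size_fps_inv_seq lt_in IHn.
Qed.

Lemma fps_mulVs (F : fieldType) (s : fps F) :
  s 0%N != 0 -> forall n, fps_mul (fps_inv s) s n = (n == 0%N)%:R.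
Proof.
move=> s0 n; rewrite /fps_mul big_ord_recr /= subnn.
rewrite {2}/fps_inv /= nth_rcons size_fps_inv_seq ltnn eqxx mulrAC mulVf // mul1r.
under [X in _ + (_ - X)]eq_bigr => i _ do rewrite nth_fps_inv_seq //.
by rewrite addrC subrK.
Qed.

(* The series of e^(c t). *)
Definition fps_exp (c : rat) : fps rat := fun n => c ^+ n / n`!%:R.

(* The series of 1 + e^t + ... + e^((a-1) t). *)
Definition genocchi_denom (a : nat) : fps rat :=
  fun n => \sum_(j < a) fps_exp j%:R n.

(* The series a t. *)
Definition genocchi_num (a : nat) : fps rat :=
  fun n => if n == 1%N then a%:R else 0.

Lemma genocchi_denom0 a : genocchi_denom a 0 = a%:R.
Proof.
rewrite /genocchi_denom (eq_bigr (fun=> 1)) ?sumr_const ?card_ord //.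
Qed.

(* G_{n,a}: the coefficients are those of t^n / n!, whence the factor n!. *)
Definition genocchi (a n : nat) : rat :=
  n`!%:R * fps_div (genocchi_num a) (genocchi_denom a) n.

Definition pi_part (a n : nat) : nat :=
  (\max_(d <- divisors n | coprime d a) d)%N.

Lemma pi_partE a n : (0 < a)%N -> (0 < n)%N -> pi_part a n = (n`_(\pi(a)^'))%N.
Proof.
move=> a0 n0.
have cop d : (0 < d)%N -> coprime d a = (\pi(a)^').-nat d.
  by move=> d0; rewrite coprime_sym coprime_pi'.
have mem d : (d \in divisors n) = (d %| n)%N by rewrite -dvdn_divisors.
apply/eqP; rewrite eqn_leq; apply/andP; split.
  apply/bigmax_leqP_seq => d; rewrite mem => dn.
  have d0 := dvdn_gt0 n0 dn; rewrite cop // => /part_pnat_id <-.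
  by rewrite dvdn_leq ?part_gt0 // partn_dvd.
apply: (@leq_bigmax_seq _ _ _ id); first by rewrite mem dvdn_part.
by rewrite cop ?part_gt0 // part_pnat.
Qed.

(* Main.v *)
Require Import Defs.
From mathcomp Require Import all_boot all_order all_algebra.
From mathcomp Require Import ring.
Set Implicit Arguments.
Unset Strict Implicit.
Unset Printing Implicit Defensive.
Import Order.TTheory GRing.Theory Num.Theory.
Local Open Scope ring_scope.

(** Let D = 1 + e^t + ... + e^((a-1)t) be the denominator. Two facts together
    give the result. Since n! [t^n] D is an integer and D has constant
    coefficient a, the recursion for 1/D shows that a^(n-1) G_{n,a} is an
    integer multiple of n. On the other hand
    D (e^t - 1)/t = (e^(at) - 1)/t, so the generating function of the G_{n,a} is
    (e^t - 1)/U with U = (e^(at) - 1)/(at); the coefficients a^k/(k+1) of U have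
    denominators coprime to a, because a prime p has valuation at most k in
    k+1, and U has constant coefficient 1, so the denominator of G_{n,a} is
    coprime to a as well. Hence G_{n,a} is an integer, and Gauss's lemma removes
    the factor a^(n-1) from the divisibility by the part of n coprime to a. *)

Section FormalPowerSeries.
Variable F : fieldType.
Implicit Types s t u : fps F.

Lemma eq_fps_mul s s' t t' : s =1 s' -> t =1 t' -> fps_mul s t =1 fps_mul s' t'.
Proof. by move=> ss tt n; apply: eq_bigr => i _; rewrite ss tt. Qed.

(** A coefficient of a product sees only finitely many terms, so truncating to polynomials lets
    associativity be borrowed from the polynomial ring. *)
Lemma fps_mul_coefM s t N n : (n < N)%N ->
  fps_mul s t n = ((\poly_(i < N) s i) * (\poly_(i < N) t i))`_n.
Proof.
move=> ltnN; rewrite coefM; apply: eq_bigr => i _; rewrite !coef_poly.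
by rewrite !(leq_ltn_trans _ ltnN) // ?leq_subr // -ltnS.
Qed.

Lemma fps_mulA s t u : fps_mul s (fps_mul t u) =1 fps_mul (fps_mul s t) u.
Proof.
move=> n; have ltnn1 := ltnSn n.
transitivity ((\poly_(i < n.+1) s i * (\poly_(i < n.+1) t i *
   \poly_(i < n.+1) u i))`_n).
  rewrite coefM; apply: eq_bigr => i _; rewrite coef_poly ltn_ord.
  by rewrite -fps_mul_coefM // ltnS leq_subr.
rewrite mulrA coefM; apply: eq_bigr => i _; rewrite coef_poly.
by rewrite ltnS leq_subr -fps_mul_coefM.
Qed.

Lemma fps_mulr1 s : fps_mul s (fun n => (n == 0)%:R) =1 s.
Proof.
move=> n; rewrite /fps_mul big_ord_recr /= subnn mulr1 big1 ?add0r // => i _.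
by rewrite subn_eq0 leqNgt ltn_ord mulr0.
Qed.

Lemma fps_divK s t : t 0%N != 0 -> fps_mul (fps_div s t) t =1 s.
Proof.
move=> t0 n; rewrite -fps_mulA -[RHS]fps_mulr1.
by apply: eq_fps_mul => // m; rewrite fps_mulVs.
Qed.

End FormalPowerSeries.

Lemma natf_fact_neq0 n : n`!%:R != 0 :> rat.
Proof. by rewrite pnatr_eq0 -lt0n fact_gt0. Qed.

Lemma bin_factr n i : (i <= n)%N ->
  'C(n, i)%:R = n`!%:R / (i`!%:R * (n - i)`!%:R) :> rat.
Proof.
move=> lein; rewrite -(bin_fact lein) !natrM mulfK //.
by rewrite mulf_neq0 ?natf_fact_neq0.
Qed.

(** Scaling by factorials turns the Cauchy product into a binomial convolution with integer weights,
    in which integrality is visible. *)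
Lemma egf_mul (s t : fps rat) n :
  n`!%:R * fps_mul s t n = \sum_(i < n.+1)
    'C(n, i)%:R * (i`!%:R * s i) * ((n - i)`!%:R * t (n - i)%N).
Proof.
rewrite mulr_sumr; apply: eq_bigr => i _.
rewrite bin_factr -1?ltnS //.
by field; rewrite !natf_fact_neq0.
Qed.

Lemma egf_mul_recr (s t : fps rat) n :
  n`!%:R * fps_mul s t n = \sum_(i < n)
    'C(n, i)%:R * (i`!%:R * s i) * ((n - i)`!%:R * t (n - i)%N)
    + n`!%:R * s n * t 0%N.
Proof. by rewrite egf_mul big_ord_recr /= subnn binn !mul1r. Qed.

Section CoprimeDenominator.
Variable a : nat.

(** For [a] at least 2, this is the localization of the integers at those coprime to [a]; asking for
    any clearing multiplier avoids reduced fractions. *)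
Definition coprime_denom (x : rat) : Prop :=
  exists2 d : nat, coprime d a & d%:R * x \is a Num.int.

Lemma coprime_denom_nat n : coprime_denom n%:R.
Proof. by exists 1%N; rewrite ?coprime1n // mul1r natr_int. Qed.

Lemma coprime_denomB x y :
  coprime_denom x -> coprime_denom y -> coprime_denom (x - y).
Proof.
move=> [d da dx] [e ea ey]; exists (d * e)%N; first by rewrite coprimeMl da.
have -> : (d * e)%:R * (x - y) = e%:R * (d%:R * x) - d%:R * (e%:R * y) by ring.
by rewrite rpredB // rpredM // natr_int.
Qed.

Lemma coprime_denomM x y :
  coprime_denom x -> coprime_denom y -> coprime_denom (x * y).
Proof.
move=> [d da dx] [e ea ey]; exists (d * e)%N; first by rewrite coprimeMl da.
by rewrite natrM mulrACA rpredM.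
Qed.

Lemma coprime_denom_sum n (F : 'I_n -> rat) :
  (forall i, coprime_denom (F i)) -> coprime_denom (\sum_i F i).
Proof.
move=> Fa; apply: big_rec => [|i x _ xa]; first exact: coprime_denom_nat 0.
rewrite -[x]opprK -[- x]sub0r; apply: coprime_denomB => //.
by apply: coprime_denomB => //; apply: coprime_denom_nat 0.
Qed.

Lemma partn_succ_dvdn_exp k : ((k.+1)`_(\pi(a)) %| a ^ k)%N.
Proof.
apply/dvdn_partP; rewrite ?part_gt0 // => p.
rewrite pi_of_part // !inE => /andP[_ pa].
have le_log : (logn p (k.+1)`_(\pi(a)) <= k)%N.
  rewrite -ltnS; apply: leq_ltn_trans (ltn_logl p (ltn0Sn k)).
  by rewrite dvdn_leq_log // dvdn_part.
rewrite p_part.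
have p_dv_a : (p %| a)%N by move: pa; rewrite mem_primes => /and3P[].
have : (p ^ k %| a ^ k)%N by apply: dvdn_exp2r.
by apply: dvdn_trans; apply: dvdn_exp2l.
Qed.

Lemma coprime_denom_exp_divS k :
  (0 < a)%N -> coprime_denom (a%:R ^+ k / k.+1%:R).
Proof.
(* The rest of [k.+1], its [\pi(a)]-part, is absorbed by [a ^ k]. *)
move=> a_gt0; exists ((k.+1)`_(\pi(a)^'))%N.
  by rewrite coprime_sym coprime_pi' // part_pnat.
have /dvdnP[m am] := partn_succ_dvdn_exp k.
rewrite -natrX am -[X in _ / X%:R](partnC \pi(a)) // !natrM.
suff -> : forall x y z : rat, x != 0 -> y != 0 -> x * (z * y / (y * x)) = z.
- exact: natr_int.
- by rewrite pnatr_eq0 -lt0n part_gt0.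
- by rewrite pnatr_eq0 -lt0n part_gt0.
by move=> x y z x0 y0; field; rewrite x0.
Qed.

(** Bezout for [d] and [a ^ n] makes [x] an integer combination of [d * x] and [a ^ n * x]. *)
Lemma int_of_coprime_denom n x :
  coprime_denom x -> a%:R ^+ n * x \is a Num.int -> x \is a Num.int.
Proof.
move=> [d da dx] ax.
have /coprimezP[[u v] /= uv] : coprimez d (a ^ n)%N.
  by rewrite coprimezE !absz_nat coprimeXr.
have -> : x = u%:~R * (d%:R * x) + v%:~R * (a%:R ^+ n * x).
  rewrite !mulrA -mulrDl -natrX !pmulrn -!intrM -intrD uv.
  by rewrite mul1r.
by rewrite rpredD // rpredM // intr_int.
Qed.

End CoprimeDenominator.

Section Denominator.
Variables (a : nat) (a_gt0 : (0 < a)%N).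

Let a_neq0 : a%:R != 0 :> rat.
Proof. by rewrite pnatr_eq0 -lt0n. Qed.

Lemma genocchi_denom0_neq0 : genocchi_denom a 0 != 0.
Proof. by rewrite genocchi_denom0. Qed.

Lemma fact_genocchi_denom n :
  n`!%:R * genocchi_denom a n = (\sum_(j < a) j ^ n)%N%:R.
Proof.
rewrite mulr_sumr natr_sum; apply: eq_bigr => j _.
by rewrite /fps_exp mulrC divfK ?natf_fact_neq0 // natrX.
Qed.

(** Each step of the recursion divides only by the constant coefficient [a], so one more power of
    [a] per step suffices. *)
Lemma fps_inv_genocchi_denom_int n :
  a%:R ^+ n.+1 * (n`!%:R * fps_inv (genocchi_denom a) n) \is a Num.int.
Proof.
elim/ltn_ind: n => n IHn; set c := fps_inv _ in IHn *.
have := egf_mul_recr c (genocchi_denom a) n.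
rewrite fps_mulVs ?genocchi_denom0_neq0 // genocchi_denom0.
move/esym/(canRL (addKr _)) => ec.
rewrite exprSr -mulrA [a%:R * _]mulrC ec mulrDr mulrN mulr_sumr rpredD //.
  rewrite rpredN rpred_sum // => i _; rewrite fact_genocchi_denom.
  (* As [i < n], the power [a ^ n] contains the [a ^ i.+1] needed by the induction hypothesis. *)
  have -> : a%:R ^+ n = a%:R ^+ (n - i.+1) * a%:R ^+ i.+1 :> rat.
    by rewrite -exprD subnK.
  set x := (_ ^+ _); set y := (_ ^+ _); set S := (\sum_(j < a) _)%N%:R.
  have -> : x * y * ('C(n, i)%:R * (i`!%:R * c i) * S)
    = x * 'C(n, i)%:R * S * (y * (i`!%:R * c i)) by ring.
  by rewrite rpredM ?IHn // !rpredM ?rpredX ?natr_int.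
by rewrite !rpredM ?rpredX ?natr_int.
Qed.

(** The numerator is the monomial [a t], so the product is an index shift; trading [n.+1] factorial
    for that of [n] releases the factor [n.+1]. *)
Lemma genocchi_fps_inv n :
  genocchi a n.+1 = n.+1%:R * a%:R * (n`!%:R * fps_inv (genocchi_denom a) n).
Proof.
rewrite /genocchi /fps_div /fps_mul (bigD1 (Ordinal (isT : (1 < n.+2)%N))) //=.
rewrite big1 ?addr0 => [|[[|[|i]] //= ? _]]; rewrite ?mul0r //.
by rewrite subSS subn0 factS natrM; ring.
Qed.

(** This is D (e^t - 1)/t = (e^(at) - 1)/t: each e^(jt) contributes a difference of consecutive
    powers, and these telescope. *)
Lemma genocchi_denom_mul :
  fps_mul (genocchi_denom a) (fun k => (k.+1)`!%:R^-1)
  =1 (fun n => a%:R ^+ n.+1 / (n.+1)`!%:R).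
Proof.
move=> n; rewrite /fps_mul.
under eq_bigr => i _ do rewrite mulr_suml.
rewrite exchange_big /=.
transitivity (\sum_(0 <= j < a)
  (j.+1%:R ^+ n.+1 / (n.+1)`!%:R - j%:R ^+ n.+1 / (n.+1)`!%:R) : rat).
  rewrite big_mkord; apply: eq_bigr => j _.
  (* Expanding (1 + j)^(n+1), the top term j^(n+1) cancels the subtracted power. *)
  rewrite -mulrBl -nat1r exprDn [in RHS]big_ord_recr/=.
  rewrite subnn binn expr0 mul1r addrK mulr_suml.
  apply: eq_bigr => i _; have lein : (i <= n.+1)%N by rewrite ltnW.
  rewrite expr1n mul1r -[_ *+ 'C(_, _)]mulr_natr bin_factr // /fps_exp.
  rewrite -subSn -1?ltnS //.
  by field; rewrite !natf_fact_neq0.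
by rewrite telescope_sumr // expr0n mul0r subr0.
Qed.

(** With G the generating function, this is G U = e^t - 1 away from the constant term, which
    vanishes. *)
Lemma fps_genocchi_mul n :
  fps_mul (fun k => genocchi a k / k`!%:R) (fun k => a%:R ^+ k / (k.+1)`!%:R)
    n.+1 = (n.+1)`!%:R^-1.
Proof.
set g := fps_div (genocchi_num a) (genocchi_denom a).
have gE k : genocchi a k / k`!%:R = g k.
  by rewrite mulrC mulKf ?natf_fact_neq0.
(* The extra [a] turns U into a U = D (e^t - 1)/t, and D then cancels against [g], leaving a t (e^t
   - 1)/t. *)
apply: (mulfI a_neq0).
transitivity (fps_mul g
   (fps_mul (genocchi_denom a) (fun k => (k.+1)`!%:R^-1)) n.+1).
  rewrite mulr_sumr; apply: eq_bigr => i _; rewrite genocchi_denom_mul exprS.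
  by rewrite gE; ring.
rewrite fps_mulA.
rewrite (eq_fps_mul (fps_divK _ genocchi_denom0_neq0) (frefl _)).
rewrite /fps_mul (bigD1 (Ordinal (isT : (1 < n.+2)%N))) //=.
rewrite big1 ?addr0 => [|[[|[|i]] //= ? _]]; rewrite ?mul0r //.
by rewrite subSS subn0.
Qed.

(** Strong induction on G U = e^t - 1: as U has constant coefficient 1, solving for the last term
    needs no division. *)
Lemma coprime_denom_genocchi n : coprime_denom a (genocchi a n).
Proof.
elim/ltn_ind: n => n IHn.
case: n IHn => [|n] IHn.
  rewrite /genocchi /fps_div /fps_mul big_ord1 /genocchi_num /= mul0r mulr0.
  exact: (coprime_denom_nat a 0).
have E k : k`!%:R * (genocchi a k / k`!%:R) = genocchi a k.
  by rewrite mulrC divfK ?natf_fact_neq0.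
have := egf_mul_recr (fun k => genocchi a k / k`!%:R)
  (fun k => a%:R ^+ k / (k.+1)`!%:R) n.+1.
rewrite fps_genocchi_mul divff ?natf_fact_neq0 // mulr1n divr1 mulr1 E.
move/esym/(canRL (addKr _)) => ->; rewrite addrC.
apply: coprime_denomB; first exact: (coprime_denom_nat a 1).
apply: coprime_denom_sum => i; rewrite E.
apply: coprime_denomM.
  apply: coprime_denomM; first exact: coprime_denom_nat.
  exact: IHn.
set k := (n.+1 - i)%N.
have -> : k`!%:R * (a%:R ^+ k / (k.+1)`!%:R) = a%:R ^+ k / k.+1%:R :> rat.
  by rewrite factS natrM; field; rewrite natf_fact_neq0 nat1r pnatr_eq0.
exact: coprime_denom_exp_divS.
Qed.

End Denominator.

Theorem theorem2p1 (a : nat) (ha : (2 <= a)%N) (n : nat) (hn : (0 < n)%N) :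
  exists2 g : int, genocchi a n = g%:~R & (pi_part a n %| g)%Z.
Proof.
have a0 : (0 < a)%N by apply: ltnW.
case: n hn => // n hn.
have /intrP[m em] := fps_inv_genocchi_denom_int a0 n.
(* The [a] of the numerator supplies one of the [n.+1] factors [a] in [em], leaving exponent [n]. *)
have eG : a%:R ^+ n * genocchi a n.+1 = (m * n.+1)%:~R.
  by rewrite genocchi_fps_inv // intrM -em exprSr; ring.
have /intrP[g eg] : genocchi a n.+1 \is a Num.int.
  apply: (int_of_coprime_denom (n := n) (coprime_denom_genocchi a0 n.+1)).
  by rewrite eG intr_int.
exists g => //; move: eG; rewrite eg -natrX pmulrn -intrM => /intr_inj eG.
rewrite pi_partE //.
have co : coprimez ((n.+1)`_(\pi(a)^'))%N (a ^ n)%N.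
  rewrite coprimezE !absz_nat coprimeXr //.
  by rewrite coprime_sym coprime_pi' // part_pnat.
rewrite -(Gauss_dvdzr _ co) eG dvdz_mull //.
by rewrite dvdzE !absz_nat dvdn_part.
Qed.
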